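(* Let $a$ be a real number and let $$F_a(x)=\frac{a+(1+x)^{1/2}}{(1-x)^{1/2}}\arccos x,\qquad x\in(0,1).$$ (1) If $a\le\frac{2(\pi-2)}{4-\pi}$, then $F_a$ is strictly increasing on $(0,1)$. (2) If $a\ge 2\sqrt2$, then $F_a$ is strictly decreasing on $(0,1)$. (3) If $\frac{2(\pi-2)}{4-\pi}<a<2\sqrt2$, then $F_a$ has a unique minimum on $(0,1)$, i.e. there is exactly one point of $(0,1)$ at which $F_a$ attains its minimum over $(0,1)$.
   Context: Here $\arccos$ is the principal branch of the inverse cosine, with $\arccos 0=\pi/2$ and $\arccos 1=0$. *)

(* Defs.v *)
From Stdlib Require Import Reals.
Open Scope R_scope.

(* Stdlib's [acos] is the principal branch: acos 0 = PI/2 and acos 1 = 0.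
   On (0, 1) both radicands are positive, so neither the junk value of [sqrt]
   at negative arguments nor division by zero is involved there. *)
Definition F (a x : R) : R :=
  (a + sqrt (1 + x)) / sqrt (1 - x) * acos x.

(* Stdlib's [strict_increasing] and [strict_decreasing], relativised to the
   open interval (l, u). *)
Definition strict_increasing_on (f : R -> R) (l u : R) : Prop :=
  forall x y : R, l < x < u -> l < y < u -> x < y -> f x < f y.

Definition strict_decreasing_on (f : R -> R) (l u : R) : Prop :=
  forall x y : R, l < x < u -> l < y < u -> x < y -> f y < f x.

Definition attains_min_on (f : R -> R) (l u x0 : R) : Prop :=
  l < x0 < u /\ forall x : R, l < x < u -> f x0 <= f x.

(* Main.v *)
(* Put x = cos (2 t) with 0 < t < PI / 4 and b = a / sqrt 2.  Then
   F a x = 2 G b t with G b t = t (b + cos t) / sin t, and the derivative of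
   G b has the sign of b - N t / D t, where N t = t - sin t cos t and
   D t = sin t - t cos t > 0.  The quotient N / D is strictly decreasing,
   because (N / D)' has the sign of 2 (sin t)^2 - t sin t cos t - t^2 < 0;
   it tends to 2 at 0 and its value at PI / 4 is the other threshold.  Since
   t = acos x / 2 decreases in x, the monotonicity of G is reversed in F. *)
Require Import Defs.
From Stdlib Require Import Reals Lra.
From Coquelicot Require Import Coquelicot.
Open Scope R_scope.

(** * Strict monotonicity from the sign of a derivative *)

(** The sign is asked only inside the interval: most uses start at 0, where the derivative
    vanishes. *)
Lemma pos_derive_lt (f f' : R -> R) (x y : R) :
  x < y -> (forall c, x <= c <= y -> is_derive f c (f' c)) ->
  (forall c, x < c < y -> 0 < f' c) -> f x < f y.
Proof.
intros xy df f'0.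
destruct (MVT_cor2 f f' x y xy) as [c [e cxy]].
- intros c hc; apply is_derive_Reals; auto.
- specialize (f'0 c cxy); nra.
Qed.

Lemma neg_derive_gt (f f' : R -> R) (x y : R) :
  x < y -> (forall c, x <= c <= y -> is_derive f c (f' c)) ->
  (forall c, x < c < y -> f' c < 0) -> f y < f x.
Proof.
intros xy df f'0.
destruct (MVT_cor2 f f' x y xy) as [c [e cxy]].
- intros c hc; apply is_derive_Reals; auto.
- specialize (f'0 c cxy); nra.
Qed.

(** * Monotonicity of the quotient [N / D] *)

Definition N (t : R) : R := t - sin t * cos t.
Definition D (t : R) : R := sin t - t * cos t.
Definition G (b t : R) : R := t * (b + cos t) / sin t.

Lemma sin_cos_sqr (t : R) : sin t * sin t + cos t * cos t = 1.
Proof. exact (sin2_cos2 t). Qed.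

Lemma is_derive_D (t : R) : is_derive D t (t * sin t).
Proof. unfold D; auto_derive; [easy | ring]. Qed.

Lemma is_derive_N (t : R) : is_derive N t (2 * (sin t * sin t)).
Proof.
unfold N; auto_derive; [easy |].
pose proof (sin_cos_sqr t); lra.
Qed.

Lemma D_pos (t : R) : 0 < t < PI -> 0 < D t.
Proof.
intros [t0 tpi].
replace 0 with (D 0) by (unfold D; rewrite sin_0; ring).
apply pos_derive_lt with (f' := fun t => t * sin t); auto.
- intros c _; apply is_derive_D.
- intros c hc; apply Rmult_lt_0_compat; [| apply sin_gt_0]; lra.
Qed.

(** The left side and its first derivative vanish at 0, and its second derivative is
    [- 4 * sin t * D t], negative on (0, PI). *)
Lemma quotient_numerator_neg (t : R) :
  0 < t < PI -> 2 * (sin t * sin t) - t * sin t * cos t - t * t < 0.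
Proof.
set (P := fun t => 2 * (sin t * sin t) - t * sin t * cos t - t * t).
set (P' := fun t => 3 * sin t * cos t - t * (cos t * cos t - sin t * sin t)
                    - 2 * t).
assert (P'_neg : forall t, 0 < t < PI -> P' t < 0).
{ intros s [s0 spi].
  replace 0 with (P' 0) by (unfold P'; rewrite sin_0; ring).
  apply neg_derive_gt with (f' := fun t => - 4 * sin t * D t); auto.
  - intros c _; unfold P', D; auto_derive; [easy |].
    pose proof (sin_cos_sqr c); nra.
  - intros c hc.
    assert (0 < sin c) by (apply sin_gt_0; lra).
    assert (0 < D c) by (apply D_pos; lra).
    nra. }
intros [t0 tpi]; change (P t < 0).
replace 0 with (P 0) by (unfold P; rewrite sin_0; ring).
apply neg_derive_gt with (f' := P'); auto.
- intros c _; unfold P, P'; auto_derive; [easy | ring].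
- intros c hc; apply P'_neg; lra.
Qed.

Lemma quotient_decreasing (s t : R) :
  0 < s -> s < t -> t < PI -> N t / D t < N s / D s.
Proof.
intros s0 st tpi.
apply (neg_derive_gt (fun t => N t / D t)
  (fun t => (2 * (sin t * sin t) * D t - t * sin t * N t) / (D t * D t))); auto.
- intros c hc.
  assert (0 < D c) by (apply D_pos; lra).
  evar_last.
  + apply is_derive_div; [apply is_derive_N | apply is_derive_D | lra].
  + simpl; field; lra.
- intros c hc.
  assert (Dc : 0 < D c) by (apply D_pos; lra).
  assert (sc : 0 < sin c) by (apply sin_gt_0; lra).
  assert (Pc := quotient_numerator_neg c ltac:(lra)).
  replace (2 * (sin c * sin c) * D c - c * sin c * N c) with
    (sin c * (2 * (sin c * sin c) - c * sin c * cos c - c * c))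
    by (unfold D, N; ring).
  apply Rdiv_neg_pos; nra.
Qed.

(** * Comparison of [N / D] with its limit 2 at 0 *)

Lemma is_derive_sub_quotient (b t : R) :
  is_derive (fun t => b * D t - N t) t (sin t * (b * t - 2 * sin t)).
Proof.
evar_last.
- apply (is_derive_minus (fun t => b * D t) N).
  + apply is_derive_scal, is_derive_D.
  + apply is_derive_N.
- unfold minus, plus, opp, scal; simpl; unfold mult; simpl; ring.
Qed.

Lemma sub_quotient_0 (b : R) : b * D 0 - N 0 = 0.
Proof. unfold D, N; rewrite sin_0; ring. Qed.

Lemma N_lt_2D (t : R) : 0 < t < PI -> 0 < 2 * D t - N t.
Proof.
intros [t0 tpi].
rewrite <- (sub_quotient_0 2).
apply (pos_derive_lt (fun t => 2 * D t - N t)) with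
  (f' := fun t => sin t * (2 * t - 2 * sin t)); auto.
- intros c _; apply is_derive_sub_quotient.
- intros c hc; apply Rmult_lt_0_compat.
  + apply sin_gt_0; lra.
  + assert (sin c < c) by (apply sin_lt_x; lra); lra.
Qed.

Lemma cos_gt_quadratic (t : R) : 0 < t -> 1 - t * t / 2 < cos t.
Proof.
intros t0.
cut (1 - 0 * 0 / 2 - cos 0 > 1 - t * t / 2 - cos t).
{ rewrite cos_0; lra. }
apply (neg_derive_gt (fun t => 1 - t * t / 2 - cos t)) with
  (f' := fun t => sin t - t); auto.
- intros c _; auto_derive; [easy | field].
- intros c hc; assert (sin c < c) by (apply sin_lt_x; lra); lra.
Qed.

Lemma sin_gt_cubic (t : R) : 0 < t -> t - t * t * t / 6 < sin t.
Proof.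
intros t0.
cut (0 - 0 * 0 * 0 / 6 - sin 0 > t - t * t * t / 6 - sin t).
{ rewrite sin_0; lra. }
apply (neg_derive_gt (fun t => t - t * t * t / 6 - sin t)) with
  (f' := fun t => 1 - t * t / 2 - cos t); auto.
- intros c _; auto_derive; [easy | field].
- intros c hc; assert (h := cos_gt_quadratic c ltac:(lra)); lra.
Qed.

(** The cubic bound on [sin] gives [b * c - 2 * sin c < c * (b - 2 + c * c / 3)], which is negative
    while [c * c < 3 * (2 - b)]. For [b < 2] this makes [N / D] exceed [b] near 0. *)
Lemma sub_quotient_neg (b t : R) :
  0 < t < PI -> t * t <= 3 * (2 - b) -> b * D t - N t < 0.
Proof.
intros [t0 tpi] tb.
rewrite <- (sub_quotient_0 b).
apply (neg_derive_gt (fun t => b * D t - N t)) with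
  (f' := fun t => sin t * (b * t - 2 * sin t)); auto.
- intros c _; apply is_derive_sub_quotient.
- intros c hc.
  assert (0 < sin c) by (apply sin_gt_0; lra).
  assert (h := sin_gt_cubic c ltac:(lra)).
  assert (c * c < 3 * (2 - b)) by nra.
  assert (c * (c * c) < c * (3 * (2 - b))) by (apply Rmult_lt_compat_l; lra).
  assert (b * c - 2 * sin c < 0) by lra.
  nra.
Qed.

(** * Monotonicity and minimum of [G] *)

Lemma is_derive_G (b t : R) : 0 < t < PI ->
  is_derive (G b) t ((b * D t - N t) / (sin t * sin t)).
Proof.
intros ht.
assert (0 < sin t) by (apply sin_gt_0; lra).
unfold G, D, N; auto_derive; [lra |].
assert (e := sin_cos_sqr t).
field_simplify; [| lra | lra].
f_equal.
replace (sin t ^ 2) with (1 - cos t * cos t) by (rewrite <- e; ring).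
ring.
Qed.

Lemma G_increasing (b s t : R) : 0 < s -> s < t -> t < PI ->
  (forall c, s < c < t -> 0 < b * D c - N c) -> G b s < G b t.
Proof.
intros s0 st tpi h.
apply pos_derive_lt with
  (f' := fun t => (b * D t - N t) / (sin t * sin t)); auto.
- intros c hc; apply is_derive_G; lra.
- intros c hc.
  assert (0 < sin c) by (apply sin_gt_0; lra).
  apply Rdiv_lt_0_compat; [auto | nra].
Qed.

Lemma G_decreasing (b s t : R) : 0 < s -> s < t -> t < PI ->
  (forall c, s < c < t -> b * D c - N c < 0) -> G b t < G b s.
Proof.
intros s0 st tpi h.
apply neg_derive_gt with
  (f' := fun t => (b * D t - N t) / (sin t * sin t)); auto.
- intros c hc; apply is_derive_G; lra.
- intros c hc.
  assert (0 < sin c) by (apply sin_gt_0; lra).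
  apply Rdiv_neg_pos; [auto | nra].
Qed.

Lemma sub_quotient_pos (b t : R) :
  0 < t < PI -> N t / D t < b -> 0 < b * D t - N t.
Proof.
intros ht h; assert (Dt : 0 < D t) by (apply D_pos; lra).
apply Rlt_div_l in h; lra.
Qed.

Lemma quotient_le (b t : R) :
  0 < t < PI -> N t <= b * D t -> N t / D t <= b.
Proof.
intros ht h; assert (Dt : 0 < D t) by (apply D_pos; lra).
apply Rle_div_l; lra.
Qed.

Lemma quotient_ge (b t : R) :
  0 < t < PI -> b * D t <= N t -> b <= N t / D t.
Proof.
intros ht h; assert (Dt : 0 < D t) by (apply D_pos; lra).
apply Rle_div_r; lra.
Qed.

Lemma sub_quotient_lt_0 (b t : R) :
  0 < t < PI -> b < N t / D t -> b * D t - N t < 0.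
Proof.
intros ht h; assert (Dt : 0 < D t) by (apply D_pos; lra).
apply Rlt_div_r in h; lra.
Qed.

(** Since [N / D] decreases, one inequality at [z] fixes the sign of the derivative everywhere
    before [z]. Here [z] serves both as the endpoint [PI / 4] and as an interior root. *)
Lemma G_decreasing_before (b z s t : R) : 0 < z < PI -> b * D z <= N z ->
  0 < s -> s < t -> t <= z -> G b t < G b s.
Proof.
intros hz h s0 st tz.
apply G_decreasing; try lra.
intros c hc; apply sub_quotient_lt_0; [lra |].
apply Rle_lt_trans with (N z / D z).
- now apply quotient_ge.
- apply quotient_decreasing; lra.
Qed.

Lemma G_increasing_after (b z s t : R) : 0 < z < PI -> N z <= b * D z ->
  z <= s -> s < t -> t < PI -> G b s < G b t.
Proof.
intros hz h zs st tpi.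
apply G_increasing; try lra.
intros c hc; apply sub_quotient_pos; [lra |].
apply Rlt_le_trans with (N z / D z).
- apply quotient_decreasing; lra.
- now apply quotient_le.
Qed.

Lemma sub_quotient_root (b u : R) : 0 < b < 2 -> 1 / 2 < u < PI ->
  N u < b * D u -> exists z, 0 < z < u /\ b * D z = N z.
Proof.
intros hb hu h.
(* The left end [(2 - b) / 4] lies below 1/2, hence below [u], and its square is at most
   [3 * (2 - b)], so the function is negative there. *)
destruct (IVT (fun t => b * D t - N t) ((2 - b) / 4) u) as [z [hz ez]].
- intros t; apply derivable_continuous_pt.
  exists (sin t * (b * t - 2 * sin t)).
  apply is_derive_Reals, is_derive_sub_quotient.
- lra.
- apply sub_quotient_neg; nra.
- lra.
- exists z; split; [split |]; [lra | | lra].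
  (* The root differs from [u], where the function is positive. *)
  destruct (proj2 hz) as [zu | zu]; [exact zu | subst z; lra].
Qed.

Lemma G_unique_min (b u : R) : 0 < b < 2 -> 1 / 2 < u < PI ->
  N u < b * D u ->
  exists z, 0 < z < u /\ forall t, 0 < t < u -> t <> z -> G b z < G b t.
Proof.
intros hb hu h.
destruct (sub_quotient_root b u hb hu h) as [z [hz e]].
exists z; split; [exact hz |]; intros t ht tz.
destruct (Rtotal_order t z) as [l | [l | l]]; [| easy |].
- apply G_decreasing_before with z; lra.
- apply G_increasing_after with z; lra.
Qed.

(** * The substitution [x = cos (2 * t)] *)

Lemma acos_decreasing (x y : R) :
  -1 <= x -> x < y -> y <= 1 -> acos y < acos x.
Proof.
intros x1 xy y1; apply Rnot_le_lt; intros h.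
pose proof (acos_bound x); pose proof (acos_bound y).
apply cos_decr_1 in h; try lra.
rewrite !cos_acos in h; lra.
Qed.

Lemma half_acos_bound (x : R) : 0 < x < 1 -> 0 < acos x / 2 < PI / 4.
Proof.
intros hx.
assert (h0 := acos_decreasing 0 x ltac:(lra) ltac:(lra) ltac:(lra)).
assert (h1 := acos_decreasing x 1 ltac:(lra) ltac:(lra) ltac:(lra)).
rewrite acos_0 in h0; rewrite acos_1 in h1; lra.
Qed.

(** By the half-angle formulas both square roots carry a factor [sqrt 2]; cancelling it turns [a]
    into [a / sqrt 2]. *)
Lemma F_cos (a t : R) : 0 < t < PI / 4 ->
  F a (cos (2 * t)) = 2 * G (a / sqrt 2) t.
Proof.
intros ht; pose proof PI_RGT_0.
assert (0 < sin t) by (apply sin_gt_0; lra).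
assert (0 < cos t) by (apply cos_gt_0; lra).
assert (0 < sqrt 2) by (apply sqrt_lt_R0; lra).
unfold F, G; rewrite acos_cos by lra.
replace (1 + cos (2 * t)) with (2 * (cos t * cos t))
  by (rewrite cos_2a_cos; ring).
replace (1 - cos (2 * t)) with (2 * (sin t * sin t))
  by (rewrite cos_2a_sin; ring).
rewrite !(sqrt_mult_alt 2) by lra.
rewrite (sqrt_square (cos t)), (sqrt_square (sin t)) by lra.
field; lra.
Qed.

Lemma F_acos (a x : R) : 0 < x < 1 -> F a x = 2 * G (a / sqrt 2) (acos x / 2).
Proof.
intros hx; rewrite <- F_cos by now apply half_acos_bound.
replace (2 * (acos x / 2)) with (acos x) by field.
rewrite cos_acos; lra.
Qed.

(** At [PI / 4] sine and cosine agree, so [D (PI / 4) > 0] reads [1 - PI / 4 > 0] up to a positive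
    factor. *)
Lemma PI_lt_4 : PI < 4.
Proof.
pose proof PI_RGT_0.
assert (h : 0 < D (PI / 4)) by (apply D_pos; lra).
assert (0 < sin (PI / 4)) by (apply sin_gt_0; lra).
unfold D in h; rewrite <- sin_cos_PI4 in h; nra.
Qed.

(** The lower threshold for [a] is thus where the derivative of [G] changes sign at the endpoint
    [PI / 4]. *)
Lemma sub_quotient_PI4 (a : R) :
  a / sqrt 2 * D (PI / 4) - N (PI / 4) =
  (4 - PI) / 8 * (a - 2 * (PI - 2) / (4 - PI)).
Proof.
pose proof PI_lt_4.
assert (0 < sqrt 2) by (apply sqrt_lt_R0; lra).
assert (sqrt 2 * sqrt 2 = 2) by (apply sqrt_sqrt; lra).
unfold D, N; rewrite sin_PI4, cos_PI4.
(* Isolates the square of [sqrt 2], which is then replaced by 2. *)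
transitivity ((a * (1 - PI / 4) + 1) / (sqrt 2 * sqrt 2) - PI / 4).
- field; lra.
- replace (sqrt 2 * sqrt 2) with 2; field; lra.
Qed.

Theorem theorem1 (a : R) :
  (a <= 2 * (PI - 2) / (4 - PI) -> strict_increasing_on (F a) 0 1) /\
  (2 * sqrt 2 <= a -> strict_decreasing_on (F a) 0 1) /\
  (2 * (PI - 2) / (4 - PI) < a < 2 * sqrt 2 ->
     exists! x0 : R, attains_min_on (F a) 0 1 x0).
Proof.
(* [PI > 3] yields [1 / 2 < PI / 4] and a positive lower threshold. *)
pose proof PI2_3_2; pose proof PI_lt_4.
assert (s2 : 0 < sqrt 2) by (apply sqrt_lt_R0; lra).
assert (e := sub_quotient_PI4 a).
split; [| split].
- intros ha x y hx hy xy.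
  rewrite !F_acos by assumption.
  apply half_acos_bound in hx as hs; apply half_acos_bound in hy as ht.
  assert (acos y < acos x) by (apply acos_decreasing; lra).
  apply Rmult_lt_compat_l; [lra |].
  apply G_decreasing_before with (PI / 4); try lra.
  nra.
- intros ha x y hx hy xy.
  rewrite !F_acos by assumption.
  apply half_acos_bound in hx as hs; apply half_acos_bound in hy as ht.
  assert (acos y < acos x) by (apply acos_decreasing; lra).
  apply Rle_div_r in ha; [| lra].
  apply Rmult_lt_compat_l; [lra |].
  apply G_increasing; try lra.
  intros c hc.
  assert (0 < D c) by (apply D_pos; lra).
  assert (0 < 2 * D c - N c) by (apply N_lt_2D; lra).
  (* As [a / sqrt 2 >= 2] and [D c > 0], the goal follows from the case [b = 2]. *)
  nra.
- intros [ha1 ha2].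
  assert (2 * (PI - 2) / (4 - PI) > 0) by (apply Rdiv_lt_0_compat; lra).
  destruct (G_unique_min (a / sqrt 2) (PI / 4)) as [z [hz zmin]].
  + split; [apply Rdiv_lt_0_compat | apply Rlt_div_l]; lra.
  + lra.
  + nra.
  + assert (hx : 0 < cos (2 * z) < 1).
    { split; [apply cos_gt_0; lra |].
      rewrite <- cos_0; apply cos_decreasing_1; lra. }
    (* Strictness away from [cos (2 * z)] gives both minimality and uniqueness. *)
    assert (strict : forall x, 0 < x < 1 -> x <> cos (2 * z) ->
                     F a (cos (2 * z)) < F a x).
    { intros x x01 xz.
      rewrite F_cos, F_acos by assumption.
      apply Rmult_lt_compat_l; [lra |].
      apply zmin; [now apply half_acos_bound |].
      intros <-; apply xz.
      replace (2 * (acos x / 2)) with (acos x) by field.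
      rewrite cos_acos; lra. }
    exists (cos (2 * z)); split.
    * split; [exact hx |].
      intros x x01; destruct (Req_dec x (cos (2 * z))) as [-> | xz]; [lra |].
      left; now apply strict.
    * intros x [x01 xmin].
      destruct (Req_dec x (cos (2 * z))) as [-> | xz]; [easy |].
      specialize (xmin _ hx); specialize (strict x x01 xz); lra.
Qed.
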